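(* Let $K$ be a field of characteristic zero, let $(\mathfrak{g},\cdot)$ be a left Leibniz algebra over $K$, and let $(\mathfrak{g},[\,,],[\![\,,\,,\,]\!])$ be its associated Lie-Yamaguti algebra, that is, $[x,y]:=x\cdot y-y\cdot x$ and $[\![x,y,z]\!]:=-(x\cdot y)\cdot z$ for all $x,y,z\in\mathfrak{g}$. Let $(V_1,l_1,r_1)$ and $(V_2,l_2,r_2)$ be two equivalent left representations of $(\mathfrak{g},\cdot)$. For $i=1,2$ let $(V_i,\rho_i,\theta_i)$ be the associated representation of $(\mathfrak{g},[\,,],[\![\,,\,,\,]\!])$, given by $\rho_i(x):=l_i(x)-r_i(x)$ and $\theta_i(x,y):=-r_i(y)\,r_i(x)$ for all $x,y\in\mathfrak{g}$. Then $(V_1,\rho_1,\theta_1)$ and $(V_2,\rho_2,\theta_2)$ are equivalent representations of $(\mathfrak{g},[\,,],[\![\,,\,,\,]\!])$.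
   Context: All vector spaces and algebras are over a field of characteristic zero. Juxtaposition of linear maps denotes composition, and for endomorphisms $f,g$ of a vector space, $[f,g]=fg-gf$. **Left Leibniz algebra.** A vector space $\mathfrak{g}$ with a bilinear map $\cdot:\mathfrak{g}\times\mathfrak{g}\to\mathfrak{g}$ satisfying $x\cdot(y\cdot z)=(x\cdot y)\cdot z+y\cdot(x\cdot z)$ for all $x,y,z\in\mathfrak{g}$. **Left representation.** A left representation of a left Leibniz algebra $(\mathfrak{g},\cdot)$ is a triple $(V,l,r)$ where $V$ is a vector space and $l,r:\mathfrak{g}\to \mathrm{End}(V)$ are linear maps such that for all $x,y\in\mathfrak{g}$: $l(x\cdot y)=[l(x),l(y)]$; $r(x\cdot y)=r(y)r(x)+l(x)r(y)$; $r(x\cdot y)=[l(x),r(y)]$. **Equivalence of left representations.** $(V_1,l_1,r_1)$ and $(V_2,l_2,r_2)$ are equivalent if there is a linear isomorphism $\psi:V_1\to V_2$ such that $\psi l_1(x)=l_2(x)\psi$ and $\psi r_1(x)=r_2(x)\psi$ for all $x\in\mathfrak{g}$. **Lie-Yamaguti algebra.** A triple $(\mathfrak{g},[\,,],[\![\,,\,,\,]\!])$ where $\mathfrak{g}$ is a vector space, $[\,,]$ is a bilinear and $[\![\,,\,,\,]\!]$ a trilinear operation on $\mathfrak{g}$ with values in $\mathfrak{g}$, such that for all $u,v,w,x,y,z\in\mathfrak{g}$ (with $\circlearrowleft_{x,y,z}$ denoting the sum over cyclic permutations of $x,y,z$): - $[x,y]=-[y,x]$; - $[\![x,y,z]\!]=-[\![y,x,z]\!]$;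 - $\circlearrowleft_{x,y,z}([[x,y],z]+[\![x,y,z]\!])=0$; - $\circlearrowleft_{x,y,z}[\![[x,y],z,u]\!]=0$; - $[\![x,y,[u,v]]\!]=[[\![x,y,u]\!],v]+[u,[\![x,y,v]\!]]$; - $[\![x,y,[\![u,v,w]\!]]\!]=[\![[\![x,y,u]\!],v,w]\!]+[\![u,[\![x,y,v]\!],w]\!]+[\![u,v,[\![x,y,w]\!]]\!]$. It is a known fact that every left Leibniz algebra $(\mathfrak{g},\cdot)$ is a Lie-Yamaguti algebra with the operations $[x,y]=x\cdot y-y\cdot x$ and $[\![x,y,z]\!]=-(x\cdot y)\cdot z$; this is called its associated Lie-Yamaguti algebra. **Representation of a Lie-Yamaguti algebra.** A representation of $(\mathfrak{g},[\,,],[\![\,,\,,\,]\!])$ is a quadruple $(V,\rho,\theta,D)$ where $V$ is a vector space, $\rho:\mathfrak{g}\to\mathrm{End}(V)$ is linear and $\theta,D:\mathfrak{g}\times\mathfrak{g}\to\mathrm{End}(V)$ are bilinear, such that for all $u,v,x,y,z\in\mathfrak{g}$: - (R1) $D(x,y)-\theta(y,x)+\theta(x,y)+\rho([x,y])-[\rho(x),\rho(y)]=0$; - (R2) $D([x,y],z)+D([y,z],x)+D([z,x],y)=0$; - (R3) $\theta([x,y],z)=\theta(x,z)\rho(y)-\theta(y,z)\rho(x)$; - (R4) $[D(x,y),\rho(z)]=\rho([\![x,y,z]\!])$; - (R5) $\theta(x,[y,z])=\rho(y)\theta(x,z)-\rho(z)\theta(x,y)$; - (R6) $[D(u,v),\theta(x,y)]=\theta([\![u,v,x]\!],y)+\theta(x,[\![u,v,y]\!])$;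 - (R7) $\theta(u,[\![x,y,z]\!])=\theta(y,z)\theta(u,x)-\theta(x,z)\theta(u,y)+D(x,y)\theta(u,z)$. Since $D$ is determined by $\rho$ and $\theta$ through (R1), such a representation is written simply $(V,\rho,\theta)$. **Associated representation.** For a left representation $(V,l,r)$ of $(\mathfrak{g},\cdot)$, the maps $\rho(x)=l(x)-r(x)$, $\theta(x,y)=-r(y)r(x)$, $D(x,y)=-l(x\cdot y)$ define a representation of the associated Lie-Yamaguti algebra, called the associated representation. **Equivalence of representations of a Lie-Yamaguti algebra.** $(V_1,\rho_1,\theta_1)$ and $(V_2,\rho_2,\theta_2)$ are equivalent if there is a linear isomorphism $\psi:V_1\to V_2$ such that $\psi\rho_1(x)=\rho_2(x)\psi$ and $\psi\theta_1(x,y)=\theta_2(x,y)\psi$ for all $x,y\in\mathfrak{g}$. *)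

(* Defs.v *)
From HB Require Import structures.
From mathcomp Require Import all_boot all_algebra.

Set Implicit Arguments.
Unset Strict Implicit.
Unset Printing Implicit Defensive.

Import GRing.Theory.
Local Open Scope ring_scope.

(* End(V) is the type {linear V -> V}, with its vector space structure taken  *)
(* pointwise: linearity or multilinearity of an End(V)-valued map is stated   *)
(* at each vector of V, and identities between endomorphisms hold at each     *)
(* vector of V.                                                               *)

Definition trilinear (K : fieldType) (g : lmodType K) (t : g -> g -> g -> g) :=
  [/\ forall y z, linear (fun x => t x y z),
      forall x z, linear (fun y => t x y z)
    & forall x y, linear (t x y)].

Definition endo_comm (K : fieldType) (V : lmodType K) (f h : V -> V) : V -> V :=
  (f \o h) \- (h \o f).

Record leibniz (K : fieldType) (g : lmodType K) := Leibniz {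
  leib_mul :> {bilinear g -> g -> g};
  leib_identity : forall x y z,
    leib_mul x (leib_mul y z)
    = leib_mul (leib_mul x y) z + leib_mul y (leib_mul x z) }.

Record left_rep (K : fieldType) (g : lmodType K) (m : leibniz g)
    (V : lmodType K) := LeftRep {
  lrep_l : g -> {linear V -> V};
  lrep_r : g -> {linear V -> V};
  lrep_l_linear : forall v, linear (fun x => lrep_l x v);
  lrep_r_linear : forall v, linear (fun x => lrep_r x v);
  lrep_lM : forall x y, lrep_l (m x y) =1 endo_comm (lrep_l x) (lrep_l y);
  lrep_rM : forall x y,
    lrep_r (m x y) =1 (lrep_r y \o lrep_r x) \+ (lrep_l x \o lrep_r y);
  lrep_rM_comm : forall x y, lrep_r (m x y) =1 endo_comm (lrep_l x) (lrep_r y) }.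

Definition left_rep_equiv (K : fieldType) (g : lmodType K) (m : leibniz g)
    (V1 V2 : lmodType K) (M1 : left_rep m V1) (M2 : left_rep m V2) : Prop :=
  exists psi : {linear V1 -> V2},
    [/\ bijective psi,
        forall x, psi \o lrep_l M1 x =1 lrep_l M2 x \o psi
      & forall x, psi \o lrep_r M1 x =1 lrep_r M2 x \o psi].

Record lie_yamaguti (K : fieldType) (g : lmodType K) := LieYamaguti {
  ly_br : {bilinear g -> g -> g};
  ly_tri : g -> g -> g -> g;
  ly_tri_trilinear : trilinear ly_tri;
  ly_brC : forall x y, ly_br x y = - ly_br y x;
  ly_triC : forall x y z, ly_tri x y z = - ly_tri y x z;
  ly_cyclic3 : forall x y z,
    (ly_br (ly_br x y) z + ly_tri x y z)
    + (ly_br (ly_br y z) x + ly_tri y z x)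
    + (ly_br (ly_br z x) y + ly_tri z x y) = 0;
  ly_cyclic4 : forall x y z u,
    ly_tri (ly_br x y) z u + ly_tri (ly_br y z) x u + ly_tri (ly_br z x) y u
    = 0;
  ly_tri_br : forall x y u v,
    ly_tri x y (ly_br u v) = ly_br (ly_tri x y u) v + ly_br u (ly_tri x y v);
  ly_tri_tri : forall x y u v w,
    ly_tri x y (ly_tri u v w)
    = ly_tri (ly_tri x y u) v w + ly_tri u (ly_tri x y v) w
      + ly_tri u v (ly_tri x y w) }.

Record ly_rep (K : fieldType) (g : lmodType K) (L : lie_yamaguti g)
    (V : lmodType K) := LYRep {
  lyr_rho : g -> {linear V -> V};
  lyr_theta : g -> g -> {linear V -> V};
  lyr_D : g -> g -> {linear V -> V};
  lyr_rho_linear : forall v, linear (fun x => lyr_rho x v);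
  lyr_theta_bilinear : forall v,
    bilinear_for *:%R *:%R (fun x y => lyr_theta x y v);
  lyr_D_bilinear : forall v, bilinear_for *:%R *:%R (fun x y => lyr_D x y v);
  lyr_R1 : forall x y v,
    lyr_D x y v - lyr_theta y x v + lyr_theta x y v + lyr_rho (ly_br L x y) v
    - endo_comm (lyr_rho x) (lyr_rho y) v = 0;
  lyr_R2 : forall x y z v,
    lyr_D (ly_br L x y) z v + lyr_D (ly_br L y z) x v
    + lyr_D (ly_br L z x) y v = 0;
  lyr_R3 : forall x y z,
    lyr_theta (ly_br L x y) z
    =1 (lyr_theta x z \o lyr_rho y) \- (lyr_theta y z \o lyr_rho x);
  lyr_R4 : forall x y z,
    endo_comm (lyr_D x y) (lyr_rho z) =1 lyr_rho (ly_tri L x y z);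
  lyr_R5 : forall x y z,
    lyr_theta x (ly_br L y z)
    =1 (lyr_rho y \o lyr_theta x z) \- (lyr_rho z \o lyr_theta x y);
  lyr_R6 : forall u v x y,
    endo_comm (lyr_D u v) (lyr_theta x y)
    =1 lyr_theta (ly_tri L u v x) y \+ lyr_theta x (ly_tri L u v y);
  lyr_R7 : forall u x y z,
    lyr_theta u (ly_tri L x y z)
    =1 (lyr_theta y z \o lyr_theta u x) \- (lyr_theta x z \o lyr_theta u y)
       \+ (lyr_D x y \o lyr_theta u z) }.

(* D plays no role here: it is determined by rho and theta through (R1).      *)
Definition ly_rep_equiv (K : fieldType) (g : lmodType K) (L : lie_yamaguti g)
    (V1 V2 : lmodType K) (M1 : ly_rep L V1) (M2 : ly_rep L V2) : Prop :=
  exists psi : {linear V1 -> V2},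
    [/\ bijective psi,
        forall x, psi \o lyr_rho M1 x =1 lyr_rho M2 x \o psi
      & forall x y, psi \o lyr_theta M1 x y =1 lyr_theta M2 x y \o psi].

(* Proves an identity of a zmodType by moving all summands to the left-hand   *)
(* side and cancelling the opposite ones; unification is needed because equal *)
(* summands may differ in the structures through which their types are read.  *)
Ltac zmod_pull a :=
  lazymatch goal with
  | |- _ + ?R = 0 =>
    lazymatch R with
    | ?c + _ =>
      tryif unify c a then idtac
      else (first [rewrite (addrCA _ a) | rewrite (addrC _ a)]; zmod_pull a)
    | _ => idtac
    end
  end.
Ltac zmod_cancel :=
  rewrite ?addr0 ?add0r;
  lazymatch goal with
  | |- 0 = 0 => reflexivity
  | |- - ?a + _ = 0 =>
    zmod_pull a; first [rewrite addKr | rewrite addNr]; zmod_cancel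
  | |- ?a + _ = 0 =>
    zmod_pull (- a); first [rewrite addNKr | rewrite subrr]; zmod_cancel
  end.
Ltac zmod :=
  apply/eqP; rewrite -subr_eq0; apply/eqP;
  rewrite ?(opprD, opprK, oppr0) -?addrA; zmod_cancel.

Section LieYamagutiOfLeibniz.

Variables (K : fieldType) (g : lmodType K) (m : leibniz g).

Definition leib_br (x y : g) : g := m x y - m y x.

Definition leib_tri (x y z : g) : g := - m (m x y) z.

Fact leib_br_bilinear : bilinear_for *:%R *:%R leib_br.
Proof.
by split=> z a x y; rewrite /leib_br /= linearPl linearPr /= scalerBr; zmod.
Qed.

HB.instance Definition _ :=
  bilinear_isBilinear.Build K g g g *:%R *:%R leib_br leib_br_bilinear.

Fact leib_tri_trilinear : trilinear leib_tri.
Proof.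
split=> y z a u v; rewrite /leib_tri /= ?(linearPl, linearPr) ?scalerN;
  by rewrite ?(linearPl, linearPr) opprD.
Qed.

Fact leib_brC x y : leib_br x y = - leib_br y x.
Proof. by rewrite /leib_br opprB. Qed.

Lemma leib_mulA x y z : m (m x y) z = m x (m y z) - m y (m x z).
Proof. by rewrite leib_identity addrK. Qed.

Fact leib_triC x y z : leib_tri x y z = - leib_tri y x z.
Proof. by rewrite /leib_tri !leib_mulA; zmod. Qed.

Fact leib_cyclic3 x y z :
  (leib_br (leib_br x y) z + leib_tri x y z)
  + (leib_br (leib_br y z) x + leib_tri y z x)
  + (leib_br (leib_br z x) y + leib_tri z x y) = 0.
Proof.
by rewrite /leib_br /leib_tri !(linearBl, linearBr) !leib_mulA; zmod.
Qed.

Fact leib_cyclic4 x y z u :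
  leib_tri (leib_br x y) z u + leib_tri (leib_br y z) x u
  + leib_tri (leib_br z x) y u = 0.
Proof.
rewrite /leib_br /leib_tri !(linearBl, linearBr) !leib_mulA.
by rewrite !linearBr; zmod.
Qed.

Fact leib_tri_br x y u v :
  leib_tri x y (leib_br u v)
  = leib_br (leib_tri x y u) v + leib_br u (leib_tri x y v).
Proof.
rewrite /leib_br /leib_tri !(linearBr, linearNl, linearNr).
by rewrite !(leib_identity m (m x y)); zmod.
Qed.

Fact leib_tri_tri x y u v w :
  leib_tri x y (leib_tri u v w)
  = leib_tri (leib_tri x y u) v w + leib_tri u (leib_tri x y v) w
    + leib_tri u v (leib_tri x y w).
Proof.
rewrite /leib_tri !(linearNl, linearNr) (leib_identity m (m x y)).
by rewrite (leib_identity m (m x y)) linearDl; zmod.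
Qed.

Definition leib_ly : lie_yamaguti g :=
  LieYamaguti (ly_br := leib_br) leib_tri_trilinear leib_brC leib_triC
    leib_cyclic3 leib_cyclic4 leib_tri_br leib_tri_tri.

End LieYamagutiOfLeibniz.

Section AssociatedRepresentation.

Variables (K : fieldType) (g : lmodType K) (m : leibniz g).
Variables (V : lmodType K) (M : left_rep m V).

Definition assoc_rho (x : g) : {linear V -> V} := lrep_l M x \- lrep_r M x.

Definition assoc_theta (x y : g) : {linear V -> V} :=
  \- (lrep_r M y \o lrep_r M x).

Definition assoc_D (x y : g) : {linear V -> V} := \- lrep_l M (m x y).

Lemma lrep_lB x y v : lrep_l M (x - y) v = lrep_l M x v - lrep_l M y v.
Proof. exact: (zmod_morphism_linear (lrep_l_linear M v)). Qed.

Lemma lrep_rB x y v : lrep_r M (x - y) v = lrep_r M x v - lrep_r M y v.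
Proof. exact: (zmod_morphism_linear (lrep_r_linear M v)). Qed.

Lemma lrep_lN x v : lrep_l M (- x) v = - lrep_l M x v.
Proof. by rewrite -[- x]sub0r lrep_lB -(subrr x) lrep_lB subrr sub0r. Qed.

Lemma lrep_rN x v : lrep_r M (- x) v = - lrep_r M x v.
Proof. by rewrite -[- x]sub0r lrep_rB -(subrr x) lrep_rB subrr sub0r. Qed.

Lemma lrep_lvB x v w : lrep_l M x (v - w) = lrep_l M x v - lrep_l M x w.
Proof. exact: linearB. Qed.

Lemma lrep_rvB x v w : lrep_r M x (v - w) = lrep_r M x v - lrep_r M x w.
Proof. exact: linearB. Qed.

Lemma lrep_lvN x v : lrep_l M x (- v) = - lrep_l M x v.
Proof. exact: linearN. Qed.

Lemma lrep_rvN x v : lrep_r M x (- v) = - lrep_r M x v.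
Proof. exact: linearN. Qed.

Definition lrepE := (lrep_lB, lrep_rB, lrep_lN, lrep_rN,
  lrep_lvB, lrep_rvB, lrep_lvN, lrep_rvN).

Lemma lrep_lMv x y v :
  lrep_l M (m x y) v = lrep_l M x (lrep_l M y v) - lrep_l M y (lrep_l M x v).
Proof. exact: lrep_lM. Qed.

Lemma lrep_rMv x y v :
  lrep_r M (m x y) v = lrep_l M x (lrep_r M y v) - lrep_r M y (lrep_l M x v).
Proof. exact: lrep_rM_comm. Qed.

(* Comparison of the two expressions of r (x . y).                            *)
Lemma lrep_rr x y v :
  lrep_r M y (lrep_r M x v) = - lrep_r M y (lrep_l M x v).
Proof.
have := lrep_rM M x y v; rewrite lrep_rMv /= addrC => /addIr <-; exact: erefl.
Qed.

Lemma lrep_rlr x y z v :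
  lrep_r M z (lrep_l M x (lrep_r M y v))
  = - lrep_r M z (lrep_l M x (lrep_l M y v)).
Proof.
apply: oppr_inj; rewrite opprK -lrep_rr.
by rewrite (lrep_rr y x) linearN lrep_rr opprK.
Qed.

Fact assoc_rho_linear v : linear (fun x => assoc_rho x v).
Proof.
move=> a x y /=; rewrite lrep_l_linear lrep_r_linear scalerBr; zmod.
Qed.

Fact assoc_theta_bilinear v :
  bilinear_for *:%R *:%R (fun x y => assoc_theta x y v).
Proof.
split=> z a x y /=.
  by rewrite lrep_r_linear linearP opprD scalerN.
by rewrite lrep_r_linear opprD scalerN.
Qed.

Fact assoc_D_bilinear v : bilinear_for *:%R *:%R (fun x y => assoc_D x y v).
Proof.
split=> z a x y /=.
  by rewrite linearPl lrep_l_linear opprD scalerN.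
by rewrite linearPr lrep_l_linear opprD scalerN.
Qed.

Local Notation br := (leib_br m).
Local Notation tri := (leib_tri m).

Fact assoc_R1 x y v :
  assoc_D x y v - assoc_theta y x v + assoc_theta x y v + assoc_rho (br x y) v
  - endo_comm (assoc_rho x) (assoc_rho y) v = 0.
Proof.
rewrite /endo_comm /leib_br /= !lrepE /=.
rewrite !(lrep_lMv, lrep_rMv) !lrep_rr; zmod.
Qed.

Fact assoc_R2 x y z v :
  assoc_D (br x y) z v + assoc_D (br y z) x v + assoc_D (br z x) y v = 0.
Proof.
rewrite /leib_br /= !linearBl /= !(lrepE, lrep_lMv) /=; zmod.
Qed.

Fact assoc_R3 x y z :
  assoc_theta (br x y) z
  =1 (assoc_theta x z \o assoc_rho y) \- (assoc_theta y z \o assoc_rho x).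
Proof.
move=> v; rewrite /leib_br /= !lrepE /=.
rewrite !lrep_rMv !lrepE /= !(lrep_rr, lrep_rlr, lrepE); zmod.
Qed.

Fact assoc_R4 x y z :
  endo_comm (assoc_D x y) (assoc_rho z) =1 assoc_rho (tri x y z).
Proof.
move=> v; rewrite /endo_comm /leib_tri /= !lrepE.
rewrite /= (lrep_lMv (m x y)) (lrep_rMv (m x y)); zmod.
Qed.

Fact assoc_R5 x y z :
  assoc_theta x (br y z)
  =1 (assoc_rho y \o assoc_theta x z) \- (assoc_rho z \o assoc_theta x y).
Proof.
move=> v; rewrite /leib_br /= !(lrepE, lrep_rMv) /=.
rewrite !(lrep_rr, lrep_rlr, lrepE); zmod.
Qed.

Fact assoc_R6 u v x y :
  endo_comm (assoc_D u v) (assoc_theta x y)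
  =1 assoc_theta (tri u v x) y \+ assoc_theta x (tri u v y).
Proof.
move=> w; rewrite /endo_comm /leib_tri /= !lrepE /=.
rewrite !(lrep_rMv (m u v)) !lrepE; zmod.
Qed.

Fact assoc_R7 u x y z :
  assoc_theta u (tri x y z)
  =1 (assoc_theta y z \o assoc_theta u x) \- (assoc_theta x z \o assoc_theta u y)
     \+ (assoc_D x y \o assoc_theta u z).
Proof.
move=> v; rewrite /leib_tri /= !lrepE /= !opprK.
rewrite (lrep_rMv (m x y)); move: (lrep_r M u v) => w.
rewrite !lrep_lMv !lrepE /= !(lrep_rr, lrep_rlr); zmod.
Qed.

Definition assoc_rep : ly_rep (leib_ly m) V :=
  LYRep (L := leib_ly m) assoc_rho_linear assoc_theta_bilinear assoc_D_bilinear
    assoc_R1 assoc_R2 assoc_R3 assoc_R4 assoc_R5 assoc_R6 assoc_R7.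

End AssociatedRepresentation.

(* Main.v *)
Require Import Defs.
From mathcomp Require Import all_boot all_algebra.
Import GRing.Theory.
Local Open Scope ring_scope.

(** The same isomorphism [psi] serves: [assoc_rho] and [assoc_theta] are built from [l] and [r] by
    differences, opposites and composition, and a linear map that intertwines [l] and [r]
    intertwines everything so built. *)

Theorem theorem2p9 (K : fieldType) (charK0 : [pchar K] =i pred0)
    (g : lmodType K) (m : leibniz g)
    (V1 V2 : lmodType K) (M1 : left_rep m V1) (M2 : left_rep m V2) :
  left_rep_equiv M1 M2 -> ly_rep_equiv (assoc_rep M1) (assoc_rep M2).
Proof.
case=> psi [psi_bij psi_l psi_r]; exists psi; split=> // [x v|x y v] /=.
  rewrite linearB.
  by have /= -> := psi_l x v; have /= -> := psi_r x v.
rewrite linearN.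
(* [psi] crosses the composite [r y \o r x] one factor at a time: the outer one at the vector
   [lrep_r M1 x v], then the inner one at [v]. *)
by have /= -> := psi_r y (lrep_r M1 x v); have /= -> := psi_r x v.
Qed.
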